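(* Let $0<a<1$ and let $C_{\vec e_3,a}=\{x\in\mathbb{R}^3:\ \langle x/|x|,\vec e_3\rangle\le a\}$. Let $\varphi:\mathbb{R}\to\mathbb{R}$ be smooth. There is no $\varphi$-stochastically complete $[\varphi,\vec e_3]$-minimal surface $\Sigma$ contained in $C_{\vec e_3,a}$ such that $\dot\varphi(\mu(p))>\xi$ for all $p\in\Sigma$, for some constant $\xi>\frac{2a}{1-a^2}$.
   Context: Surfaces are connected, orientable, immersed in $\mathbb{R}^3$, without boundary, with unit normal $N$; $\{\vec e_1,\vec e_2,\vec e_3\}$ is the standard basis. For a surface $\Sigma$, $\mu(p)=\langle p,\vec e_3\rangle$ is the height function and $\eta=\langle N,\vec e_3\rangle$ the angle function. $\Sigma$ is $[\varphi,\vec e_3]$-minimal if its mean curvature vector $\vec H$ (trace of the second fundamental form) satisfies $\vec H=\dot\varphi(\mu)\,\eta\,N$. On $\Sigma$ write $\varphi$ for $\varphi\circ\mu$ and let $\Delta^{\varphi}u=\Delta u+\langle\nabla\varphi,\nabla u\rangle$ (induced metric). $\Sigma$ is $\varphi$-stochastically complete if for every $u\in C^2(\Sigma)$ with $u^*=\sup_\Sigma u<+\infty$ there is a sequence $p_n\in\Sigma$ with $u(p_n)>u^*-1/n$ and $\Delta^{\varphi}u(p_n)<1/n$ for all $n$. *)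

(* Defs.v *)
(* Immersed surfaces are modelled concretely:      *)
(* an abstract 2-manifold M (Hausdorff, second countable, connected) with an *)
(* immersion X : M -> R^3, smooth structure given by local parametrizations. *)
From HB Require Import structures.
From mathcomp Require Import all_boot all_order all_algebra.
From mathcomp Require Import all_classical all_reals all_analysis.
Set Implicit Arguments. Unset Strict Implicit. Unset Printing Implicit Defensive.
Import Order.TTheory GRing.Theory Num.Theory.
Import numFieldNormedType.Exports.
Local Open Scope classical_set_scope.
Local Open Scope ring_scope.

Section Defs.
Variable R : realType.

Fixpoint iter_dir (V W : normedModType R) (vs : seq V) (f : V -> W) : V -> W :=
  match vs with
  | [::] => f
  | v :: vs' => fun x => derive (iter_dir vs' f) x v
  end.

Definition Ck_on (V W : normedModType R) (k : nat) (U : set V) (f : V -> W) :=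
  (forall (vs : seq V) (v x : V), (size vs < k)%N -> U x ->
      derivable (iter_dir vs f) x v) /\
  (forall (vs : seq V) (x : V), (size vs <= k)%N -> U x ->
      {for x, continuous (iter_dir vs f)}).

Definition smooth_on (V W : normedModType R) (U : set V) (f : V -> W) :=
  forall k, Ck_on k U f.

Definition dot3 (u v : 'rV[R]_3) : R := \sum_(i < 3) u ord0 i * v ord0 i.
Definition norm3 (u : 'rV[R]_3) : R := Num.sqrt (dot3 u u).
Definition e3 : 'rV[R]_3 := \row_(i < 3) (if (i : nat) == 2%N then 1 else 0).

Definition ei (i : 'I_2) : R * R := if (i : nat) == 0%N then (1, 0) else (0, 1).

Definition pd (W : normedModType R) (f : R * R -> W) (i : 'I_2) (q : R * R) : W :=
  derive f q (ei i).
Definition metric (f : R * R -> 'rV[R]_3) (q : R * R) : 'M[R]_2 :=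
  \matrix_(i < 2, j < 2) dot3 (pd f i q) (pd f j q).
Definition imetric (f : R * R -> 'rV[R]_3) (q : R * R) : 'M[R]_2 :=
  invmx (metric f q).
Definition sqrtg (f : R * R -> 'rV[R]_3) (q : R * R) : R :=
  Num.sqrt (\det (metric f q)).

Definition lap_coord (f : R * R -> 'rV[R]_3) (w : R * R -> R) (q : R * R) : R :=
  (sqrtg f q)^-1 *
  \sum_(i < 2) pd (fun q' => sqrtg f q' *
                     \sum_(j < 2) imetric f q' i j * pd w j q') i q.

Definition grad_dot_coord (f : R * R -> 'rV[R]_3) (a w : R * R -> R) (q : R * R) : R :=
  \sum_(i < 2) \sum_(j < 2) imetric f q i j * pd a i q * pd w j q.

(* mean curvature vector = trace of the second fundamental form *)
(* II(d_i, d_j) = <d_i d_j f, N> N, traced with the inverse metric *)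
Definition meancurv_coord (f : R * R -> 'rV[R]_3) (N : 'rV[R]_3) (q : R * R)
  : 'rV[R]_3 :=
  (\sum_(i < 2) \sum_(j < 2)
      imetric f q i j * dot3 (pd (fun q' => pd f j q') i q) N) *: N.

Section Surface.
Variables (M : topologicalType) (X : M -> 'rV[R]_3).

(* admissible local parametrization: psi restricted to the open set U is a  *)
(* homeomorphism onto an open subset of M, and X \o psi is a smooth         *)
(* immersion on U                                                           *)
Definition chart (U : set (R * R)) (psi : R * R -> M) :=
  [/\ open U,
      (forall q1 q2, U q1 -> U q2 -> psi q1 = psi q2 -> q1 = q2),
      (forall q, U q -> {for q, continuous psi}),
      (forall V, open V -> V `<=` U -> open (psi @` V)) &
      smooth_on U (X \o psi) /\
      (forall q, U q -> forall a b : R,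
          a *: pd (X \o psi) ord0 q + b *: pd (X \o psi) (lift ord0 ord0) q = 0 ->
          a = 0 /\ b = 0)].

Definition immersed_surface :=
  [/\ hausdorff_space M, @second_countable M, connected [set: M] &
      (forall p, exists U psi, chart U psi /\ exists2 q, U q & psi q = p)].

Definition unit_normal (N : M -> 'rV[R]_3) :=
  [/\ continuous N, (forall p, dot3 (N p) (N p) = 1) &
      (forall U psi, chart U psi -> forall q, U q -> forall i,
          dot3 (N (psi q)) (pd (X \o psi) i q) = 0)].

Definition height (p : M) : R := dot3 (X p) e3.
Definition angle (N : M -> 'rV[R]_3) (p : M) : R := dot3 (N p) e3.

Definition C2 (u : M -> R) :=
  forall U psi, chart U psi -> Ck_on 2 U (u \o psi).

Definition phi_e3_minimal (phi : R -> R) (N : M -> 'rV[R]_3) :=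
  forall U psi, chart U psi -> forall q, U q ->
    meancurv_coord (X \o psi) (N (psi q)) q =
    (derive1 phi (height (psi q)) * angle N (psi q)) *: N (psi q).

Definition lap_phi_coord (phi : R -> R) (U : set (R * R)) (psi : R * R -> M)
  (u : M -> R) (q : R * R) : R :=
  lap_coord (X \o psi) (u \o psi) q +
  grad_dot_coord (X \o psi) (phi \o height \o psi) (u \o psi) q.

Definition phi_stoch_complete (phi : R -> R) :=
  forall u : M -> R, C2 u -> has_ubound (range u) ->
  exists pn : nat -> M, forall n : nat,
    sup (range u) - (n.+1%:R)^-1 < u (pn n) /\
    (forall U psi, chart U psi -> forall q, U q -> psi q = pn n ->
       lap_phi_coord phi U psi u q < (n.+1%:R)^-1).

End Surface.

Definition in_cone (a : R) (x : 'rV[R]_3) : Prop := dot3 x e3 <= a * norm3 x.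

End Defs.

(* Main.v *)
(* For a function G on R^3, minimality gives
     Delta^phi (G o X) = tr_T (D^2 G) + phi'(mu) (d_3 G) o X,
   tr_T being the trace over the tangent plane: the normal part of phi' e_3 is
   the mean curvature vector, its tangential part comes from the drift.
   Take G(x) = <x, e_3> - a rho with rho = sqrt (1 + |x|^2). On the cone G is
   nonpositive, d_3 G = 1 - a <x, e_3> / rho >= 1 - a^2, and
   tr_T (D^2 G) >= - 2 a / rho >= - 2 a. Hence Delta^phi (G o X) is bounded below
   by the positive constant xi (1 - a^2) - 2 a, which contradicts stochastic
   completeness. *)
Require Import Defs.
From HB Require Import structures.
From mathcomp Require Import all_boot all_order all_algebra.
From mathcomp Require Import all_classical all_reals all_analysis.
From mathcomp Require Import ring lra.
Set Implicit Arguments.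
Unset Strict Implicit.
Unset Printing Implicit Defensive.
Import Order.TTheory GRing.Theory Num.Theory.
Import numFieldNormedType.Exports.
Local Open Scope classical_set_scope.
Local Open Scope ring_scope.

(** * Euclidean algebra in R^3: Gram determinants and orthogonal frames *)

Section Dot3.
Context {R : realType}.
Implicit Types u v w : 'rV[R]_3.

Lemma dot3E u v : dot3 u v =
  u ord0 0 * v ord0 0 + u ord0 1 * v ord0 1 + u ord0 2 * v ord0 2.
Proof.
rewrite /dot3 !big_ord_recl big_ord0 addr0 addrA.
by congr (_ * _ + _ * _ + _ * _); congr (_ ord0 _); apply/val_inj.
Qed.

Lemma dot3C u v : dot3 u v = dot3 v u.
Proof. by rewrite !dot3E; ring. Qed.

Lemma dot3Dl u v w : dot3 (u + v) w = dot3 u w + dot3 v w.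
Proof. by rewrite !dot3E !mxE; ring. Qed.

Lemma dot3Zl c u w : dot3 (c *: u) w = c * dot3 u w.
Proof. by rewrite !dot3E !mxE; ring. Qed.

Lemma dot3Nl u w : dot3 (- u) w = - dot3 u w.
Proof. by rewrite !dot3E !mxE; ring. Qed.

Lemma dot3Dr u v w : dot3 w (u + v) = dot3 w u + dot3 w v.
Proof. by rewrite !(dot3C w) dot3Dl. Qed.

Lemma dot3Zr c u w : dot3 w (c *: u) = c * dot3 w u.
Proof. by rewrite !(dot3C w) dot3Zl. Qed.

Lemma dot3Nr u w : dot3 w (- u) = - dot3 w u.
Proof. by rewrite !(dot3C w) dot3Nl. Qed.

Definition dot3lin := (dot3Dl, dot3Dr, dot3Zl, dot3Zr, dot3Nl, dot3Nr).

Lemma dot3_ge0 u : 0 <= dot3 u u.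
Proof. by apply: sumr_ge0 => i _; rewrite -expr2 sqr_ge0. Qed.

Lemma row3P u v : u ord0 0 = v ord0 0 -> u ord0 1 = v ord0 1 ->
  u ord0 2 = v ord0 2 -> u = v.
Proof.
move=> h0 h1 h2; apply/rowP => i.
have [->|[->|->]] // : i = 0 \/ i = 1 \/ i = 2.
case: i => -[|[|[|//]]] lti; [left|right; left|right; right]; exact/val_inj.
Qed.

Lemma dot3_eq0 u : dot3 u u = 0 -> u = 0.
Proof.
rewrite dot3E => u0.
by apply: row3P; rewrite !mxE; nra.
Qed.

Lemma dot3_inj u v : (forall w, dot3 u w = dot3 v w) -> u = v.
Proof.
move=> uv; apply/eqP; rewrite -subr_eq0; apply/eqP/dot3_eq0.
by rewrite dot3Dl dot3Nl uv subrr.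
Qed.

Lemma e3_dot3 : dot3 (e3 R) (e3 R) = 1.
Proof. by rewrite dot3E !mxE /=; ring. Qed.

(** The vector [t] is [dot3 u u] times the component of [v] orthogonal to [u]. Its squared length is
    [dot3 u u] times the Gram determinant, and [t = 0] would be a nontrivial linear relation between
    [u] and [v]. *)
Lemma gram_gt0 u v :
  (forall a b : R, a *: u + b *: v = 0 -> a = 0 /\ b = 0) ->
  0 < dot3 u u * dot3 v v - dot3 u v ^+ 2.
Proof.
move=> free_uv.
have uu_gt0 : 0 < dot3 u u.
  rewrite lt_def dot3_ge0 andbT; apply/eqP => /dot3_eq0 u0.
  have [|/eqP] := free_uv 1 0; last by rewrite oner_eq0.
  by rewrite u0 scaler0 scale0r addr0.
set t := dot3 u u *: v - dot3 u v *: u.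
have tt : dot3 t t = dot3 u u * (dot3 u u * dot3 v v - dot3 u v ^+ 2).
  by rewrite /t !dot3lin (dot3C v u); ring.
rewrite -(pmulr_rgt0 _ uu_gt0) -tt lt_def dot3_ge0 andbT.
apply/eqP => /dot3_eq0 t0; have [|_ uu0] := free_uv (- dot3 u v) (dot3 u u).
  by rewrite -t0 /t scaleNr addrC.
by move: uu_gt0; rewrite uu0 ltxx.
Qed.

(* Cramer's rule for d = det (u, v, n), whose square is the Gram determinant. *)
Lemma orthogonal_frame_eq0 u v n w :
  0 < dot3 u u * dot3 v v - dot3 u v ^+ 2 ->
  dot3 n n = 1 -> dot3 n u = 0 -> dot3 n v = 0 ->
  dot3 w u = 0 -> dot3 w v = 0 -> dot3 w n = 0 -> w = 0.
Proof.
move=> D0 nn nu nv wu wv wn.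
pose d := u ord0 0 * (v ord0 1 * n ord0 2 - v ord0 2 * n ord0 1) +
          u ord0 1 * (v ord0 2 * n ord0 0 - v ord0 0 * n ord0 2) +
          u ord0 2 * (v ord0 0 * n ord0 1 - v ord0 1 * n ord0 0).
have d2 : d ^+ 2 = dot3 u u * (dot3 v v * dot3 n n - dot3 n v ^+ 2)
    - dot3 u v * (dot3 u v * dot3 n n - dot3 n u * dot3 n v)
    + dot3 n u * (dot3 u v * dot3 n v - dot3 v v * dot3 n u).
  by rewrite /d !dot3E; ring.
have d_neq0 : d != 0.
  rewrite -sqrf_eq0 d2 nn nu nv; apply: lt0r_neq0.
  by move: D0; congr (0 < _); ring.
have wd0 : w ord0 0 * d = dot3 w u * (v ord0 1 * n ord0 2 - v ord0 2 * n ord0 1) +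
    dot3 w v * (n ord0 1 * u ord0 2 - n ord0 2 * u ord0 1) +
    dot3 w n * (u ord0 1 * v ord0 2 - u ord0 2 * v ord0 1).
  by rewrite /d !dot3E; ring.
have wd1 : w ord0 1 * d = dot3 w u * (v ord0 2 * n ord0 0 - v ord0 0 * n ord0 2) +
    dot3 w v * (n ord0 2 * u ord0 0 - n ord0 0 * u ord0 2) +
    dot3 w n * (u ord0 2 * v ord0 0 - u ord0 0 * v ord0 2).
  by rewrite /d !dot3E; ring.
have wd2 : w ord0 2 * d = dot3 w u * (v ord0 0 * n ord0 1 - v ord0 1 * n ord0 0) +
    dot3 w v * (n ord0 0 * u ord0 1 - n ord0 1 * u ord0 0) +
    dot3 w n * (u ord0 0 * v ord0 1 - u ord0 1 * v ord0 0).
  by rewrite /d !dot3E; ring.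
move: wd0 wd1 wd2; rewrite wu wv wn !mul0r !addr0 => /eqP wd0 /eqP wd1 /eqP wd2.
by apply: row3P; rewrite mxE; apply/eqP; move: wd0 wd1 wd2;
  rewrite !mulf_eq0 (negbTE d_neq0) !orbF.
Qed.

End Dot3.

(** * Directional derivatives *)

Section Calculus.
Context {R : realType} {V : normedModType R}.

(** The two difference quotients are the same function of [h]. One-variable results thus transfer to
    directional derivatives, with no Fréchet differentiability of [f]. *)
Lemma is_derive_line (W : normedModType R) (f : V -> W) (q v : V) (t : R) df :
  is_derive (q + t *: v) v f df -> is_derive t 1 (fun s => f (q + s *: v)) df.
Proof.
suff E : (fun h : R => h^-1 *: (((fun s => f (q + s *: v)) \o shift t) (h *: 1) -
    f (q + t *: v))) = (fun h => h^-1 *: ((f \o shift (q + t *: v)) (h *: v) -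
    f (q + t *: v))).
  by move=> [fv <-]; split; rewrite /derivable /derive E.
apply/funext => h /=; congr (_ *: (f _ - _)).
by rewrite [h *: 1]mulr1 scalerDl addrCA.
Qed.

Lemma is_derive_line0 (W : normedModType R) (f : V -> W) (q v : V) df :
  is_derive (0 : R) (1 : R) (fun s : R => f (q + s *: v)) df -> is_derive q v f df.
Proof.
suff E : (fun h : R => h^-1 *: (((fun s => f (q + s *: v)) \o shift 0) (h *: 1) -
    f (q + 0 *: v))) = (fun h => h^-1 *: ((f \o shift q) (h *: v) - f q)).
  by move=> [fv <-]; split; move: fv; rewrite /derivable /derive E.
apply/funext => h /=; rewrite scale0r !addr0; congr (_ *: (f _ - _)).
by rewrite [h *: 1]mulr1 addrC.
Qed.

(** Since [f] is only assumed derivable in the direction [v], the chain rule is applied on the line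
    through [q] along [v], where derivability in one variable gives differentiability. *)
Lemma is_derive_comp1 (f : V -> R) (g : R -> R) (q v : V) df dg :
  is_derive q v f df -> is_derive (f q) 1 g dg ->
  is_derive q v (fun x => g (f x)) (dg * df).
Proof.
move=> fv gd; apply: is_derive_line0.
have lf : is_derive (0 : R) 1 (fun s => f (q + s *: v)) df.
  by apply: is_derive_line; rewrite scale0r addr0.
have {}gd : is_derive (f (q + 0 *: v)) 1 g dg by rewrite scale0r addr0.
split.
  apply/derivable1_diffP/differentiable_comp; apply/derivable1_diffP.
    exact: ex_derive.
  exact: ex_derive.
rewrite -derive1E derive1_comp ?derive1E; [|exact: ex_derive..].
by rewrite !derive_val.
Qed.

Lemma is_derive_sqrt_comp (f : V -> R) (q v : V) df :
  0 < f q -> is_derive q v f df ->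
  is_derive q v (fun x => Num.sqrt (f x)) ((2 * Num.sqrt (f q))^-1 * df).
Proof. by move=> fq0 fv; exact: is_derive_comp1 (is_derive1_sqrt fq0). Qed.

Lemma is_derive_inv_comp (f : V -> R) (q v : V) df :
  f q != 0 -> is_derive q v f df ->
  is_derive q v (fun x => (f x)^-1) (- (f q) ^- 2 * df).
Proof.
move=> fq0 fv; split; first exact: derivableV.
by rewrite deriveV // derive_val.
Qed.

Lemma is_derive_add (f g : V -> R) (q v : V) df dg :
  is_derive q v f df -> is_derive q v g dg ->
  is_derive q v (fun x => f x + g x) (df + dg).
Proof. exact: is_deriveD. Qed.

Lemma is_derive_mul (f g : V -> R) (q v : V) df dg :
  is_derive q v f df -> is_derive q v g dg ->
  is_derive q v (fun x => f x * g x) (df * g q + f q * dg).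
Proof.
move=> fv gv; apply: is_derive_eq (is_deriveM fv gv) _.
by rewrite addrC /GRing.scale /= [g q * _]mulrC.
Qed.

Lemma is_derive_dot3 (f g : V -> 'rV[R]_3) (q v : V) df dg :
  is_derive q v f df -> is_derive q v g dg ->
  is_derive q v (fun x => dot3 (f x) (g x)) (dot3 df (g q) + dot3 (f q) dg).
Proof.
have coord (h : V -> 'rV[R]_3) dh i : is_derive q v h dh ->
    is_derive q v (fun x => h x ord0 i) (dh ord0 i).
  move=> [hv <-]; split; first exact: (iffLR (derivable_mxP _ _ _) hv).
  by rewrite derive_mx // mxE.
move=> fv gv; rewrite (_ : (fun _ => _) = (fun x => f x ord0 0 * g x ord0 0 +
  f x ord0 1 * g x ord0 1 + f x ord0 2 * g x ord0 2)); last first.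
  by apply/funext => x; rewrite dot3E.
have fgv i := is_derive_mul (coord _ _ i fv) (coord _ _ i gv).
apply: is_derive_eq (is_derive_add (is_derive_add (fgv 0) (fgv 1)) (fgv 2)) _.
by rewrite !dot3E; ring.
Qed.

Lemma continuous_dot3 (T : topologicalType) (f g : T -> 'rV[R]_3) (q : T) :
  {for q, continuous f} -> {for q, continuous g} ->
  {for q, continuous (fun x => dot3 (f x) (g x))}.
Proof.
move=> fq gq.
have coord (h : T -> 'rV[R]_3) i : {for q, continuous h} ->
    {for q, continuous (fun x => h x ord0 i)}.
  move=> hq; apply: (@continuous_comp _ _ _ h (fun M : 'rV[R]_3 => M ord0 i)) => //.
  exact: coord_continuous.
rewrite (_ : (fun _ => _) = (fun x => f x ord0 0 * g x ord0 0 +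
  f x ord0 1 * g x ord0 1 + f x ord0 2 * g x ord0 2)); last first.
  by apply/funext => x; rewrite dot3E.
by repeat apply: continuousD; apply: continuousM; apply: coord.
Qed.

End Calculus.

(** * Second directional derivatives: Schwarz symmetry and a criterion for class C^2 *)

Section SecondDerivatives.
Context {R : realType} {V : normedModType R}.
Implicit Types (U : set V) (f : V -> R) (q v w : V).

Lemma line_MVT f q v (s : R) : 0 < s ->
  (forall t, 0 <= t <= s -> derivable f (q + t *: v) v) ->
  exists2 t, 0 <= t <= s &
    f (q + s *: v) - f q = s * 'D_v f (q + t *: v).
Proof.
move=> s0 dv.
have dl t : t \in `[0, s] ->
    is_derive t (1 : R) (fun t => f (q + t *: v)) ('D_v f (q + t *: v)).
  by rewrite in_itv /= => ts; apply/is_derive_line/derivableP/dv.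
have dl_oo t : t \in `]0, s[ ->
    is_derive t (1 : R) (fun t => f (q + t *: v)) ('D_v f (q + t *: v)).
  by move=> ts; apply: dl; apply: subset_itv_oo_cc ts.
have cl : {within `[0, s], continuous (fun t : R => f (q + t *: v))}.
  by apply: derivable_within_continuous => t /dl[].
have [t] := @MVT_segment R _ _ 0 s (ltW s0) dl_oo cl.
by rewrite in_itv /= scale0r addr0 subr0 mulrC => ts ->; exists t.
Qed.

(** The second difference over the parallelogram is the increment along [v] of
    [g x = f (x + s w) - f x]. The mean value theorem is applied to [g] along [v], then to ['D_v f]
    along [w]. *)
Lemma mixed_difference U f q v w (s : R) : 0 < s ->
  (forall t r : R, 0 <= t <= s -> 0 <= r <= s -> U (q + t *: v + r *: w)) ->
  (forall x, U x -> derivable f x v) ->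
  (forall x, U x -> derivable ('D_v f) x w) ->
  exists t r, [/\ 0 <= t <= s, 0 <= r <= s &
    f (q + s *: v + s *: w) - f (q + s *: v) - f (q + s *: w) + f q =
    s ^+ 2 * 'D_w ('D_v f) (q + t *: v + r *: w)].
Proof.
move=> s0 Uq dv dw.
have ss : 0 <= s <= s by rewrite ltW /=.
have s00 : 0 <= (0 : R) <= s by rewrite lexx ltW.
pose g x := f (x + s *: w) - f x.
have dg t : 0 <= t <= s -> is_derive (q + t *: v) v g
    ('D_v f (q + t *: v + s *: w) - 'D_v f (q + t *: v)).
  move=> ts; apply: is_deriveB; last first.
    by apply/derivableP/dv; have := Uq t 0 ts s00; rewrite scale0r addr0.
  apply: is_derive_line0.
  suff E : (fun r : R => f (q + t *: v + r *: v + s *: w)) =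
      (fun r : R => f (q + t *: v + s *: w + r *: v)).
    rewrite E; apply: is_derive_line; rewrite scale0r addr0.
    by apply/derivableP/dv/Uq.
  by apply/funext => r; rewrite addrAC.
have [t ts] := line_MVT s0 (fun t ts => @ex_derive _ _ _ _ _ _ _ (dg t ts)).
have -> := @derive_val _ _ _ _ _ _ _ (dg t ts).
have [|r rs ->] := @line_MVT ('D_v f) (q + t *: v) w s s0.
  by move=> r rs; apply/dw/Uq.
move=> E; exists t, r; split => //.
by rewrite expr2 -mulrA -E /g; ring.
Qed.

Lemma dist_le_split (a b c e : R) :
  `|a - c| < e / 2 -> `|b - c| < e / 2 -> `|a - b| <= e.
Proof.
move=> ac bc; rewrite -(subrKA c) (le_trans (ler_normD _ _)) // (splitr e).
by rewrite lerD // ltW // distrC.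
Qed.

(** Schwarz's theorem. The second difference is symmetric in [v] and [w], so [mixed_difference] in
    both orders equates the two mixed derivatives at two points close to [q]; continuity at [q]
    concludes. *)
Lemma derive_comm U f q v w : open U -> U q ->
  (forall x, U x -> derivable f x v /\ derivable f x w) ->
  (forall x, U x -> derivable ('D_v f) x w /\ derivable ('D_w f) x v) ->
  {for q, continuous ('D_w ('D_v f))} -> {for q, continuous ('D_v ('D_w f))} ->
  'D_w ('D_v f) q = 'D_v ('D_w f) q.
Proof.
move=> oU Uq df ddf cwv cvw; apply/eqP; rewrite -subr_eq0 -normr_le0.
apply/ler_addgt0Pr => e e0; rewrite add0r.
have e20 : 0 < e / 2 by rewrite divr_gt0.
pose good := [set x | [/\ U x, `|'D_w ('D_v f) q - 'D_w ('D_v f) x| < e / 2 &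
   `|'D_v ('D_w f) q - 'D_v ('D_w f) x| < e / 2]].
have ngood : nbhs q good.
  have nU : nbhs q U by exact: open_nbhs_nbhs.
  move/cvgrPdist_lt : cwv => /(_ _ e20) n1.
  move/cvgrPdist_lt : cvw => /(_ _ e20) n2.
  exact: (filterS3 _ (fun x a b c => And3 a b c) nU n1 n2).
have [d /= d0 dgood] := (nbhs_ballP _ _).1 ngood.
(* With this [s] every point of the parallelogram is within [d / 2] of [q]; the summand 1 keeps the
   denominator positive even if [v] and [w] vanish. *)
pose s := d / 2 / (1 + `|v| + `|w|).
have k0 : 0 < 1 + `|v| + `|w| by rewrite ltr_pwDl // ltr_pwDl.
have s0 : 0 < s by rewrite !divr_gt0.
have box t r : 0 <= t <= s -> 0 <= r <= s -> good (q + t *: v + r *: w).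
  move=> /andP[t0 ts] /andP[r0 rs]; apply: dgood.
  rewrite -ball_normE /= opprD addrA opprD addrA subrr sub0r -opprD normrN.
  apply: le_lt_trans (ler_normD _ _) _; rewrite !normrZ !ger0_norm //.
  apply: (@le_lt_trans _ _ (s * (1 + `|v| + `|w|))).
    rewrite !mulrDr -addrA; apply: ler_wpDl; first by rewrite mulr1 ltW.
    by apply: lerD; apply: ler_wpM2r.
  by rewrite divfK ?gt_eqF // gtr_pMr // invf_lt1 // ltr1n.
have [t [r [ts rs E1]]] := mixed_difference s0
  (fun t r ts rs => let: And3 h _ _ := box t r ts rs in h)
  (fun x Ux => (df x Ux).1) (fun x Ux => (ddf x Ux).1).
have [t' [r' [ts' rs' E2]]] : exists t r, [/\ 0 <= t <= s, 0 <= r <= s &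
    f (q + s *: w + s *: v) - f (q + s *: w) - f (q + s *: v) + f q =
    s ^+ 2 * 'D_v ('D_w f) (q + t *: w + r *: v)].
  apply: (@mixed_difference U f q w v s s0).
  - by move=> t' r' ts' rs'; rewrite addrAC; have [Ux _ _] := box r' t' rs' ts'.
  - exact: (fun x Ux => (df x Ux).2).
  - exact: (fun x Ux => (ddf x Ux).2).
have E : 'D_w ('D_v f) (q + t *: v + r *: w) = 'D_v ('D_w f) (q + t' *: w + r' *: v).
  apply: (mulfI (x := s ^+ 2)); first by rewrite expf_neq0 ?gt_eqF.
  apply: etrans (esym E1) (etrans _ E2).
  by rewrite (addrAC q (s *: w)) [X in _ = X + _]addrAC.
have [_ g1 _] := box _ _ ts rs; have [_ _] := box _ _ rs' ts'.
rewrite addrAC -E; exact: dist_le_split g1.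
Qed.

(** The candidates [D] and [DD] agree with the iterated derivatives only on [U]. Since [U] is open,
    they agree near each of its points, and that is enough to carry over derivability and
    continuity. *)
Lemma Ck_on2_intro U f (D : V -> V -> R) (DD : V -> V -> V -> R) : open U ->
  (forall x, U x -> {for x, continuous f}) ->
  (forall v x, U x -> is_derive x v f (D v x)) ->
  (forall v x, U x -> {for x, continuous (D v)}) ->
  (forall v w x, U x -> is_derive x w (D v) (DD v w x)) ->
  (forall v w x, U x -> {for x, continuous (DD v w)}) ->
  Ck_on 2 U f.
Proof.
move=> oU cf df cD dD cDD.
have ne (g h : V -> R) x : U x -> (forall x, U x -> g x = h x) ->
    {near x, g =1 h}.
  move=> Ux gh; near=> y; apply: gh; near: y; exact: open_nbhs_nbhs.
have E1 v x : U x -> 'D_v f x = D v x by move=> /(df v)/@derive_val.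
have dD' v w x : U x -> is_derive x w ('D_v f) (DD v w x).
  move=> Ux; apply: near_eq_is_derive (dD v w x Ux).
  by apply: (ne) => // y /E1.
have E2 v w x : U x -> 'D_w ('D_v f) x = DD v w x by move=> /(dD' v w)/@derive_val.
have cont (g h : V -> R) x : U x -> (forall x, U x -> g x = h x) ->
    {for x, continuous h} -> {for x, continuous g}.
  move=> Ux gh; rewrite /prop_for /continuous_at gh // => hx.
  apply: cvg_trans hx; apply: near_eq_cvg; apply: (ne) => // y Uy.
  exact/esym/gh.
(* [iter_dir] differentiates along the head of the list last, so the list [[:: v; w]] corresponds to
   [DD w v]. *)
split=> [[|u [|u' vs]] w x sz Ux|[|v [|w [|u vs]]] x sz Ux].
- exact: (@ex_derive _ _ _ _ _ _ _ (df w x Ux)).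
- exact: (@ex_derive _ _ _ _ _ _ _ (dD' u w x Ux)).
- by case: (notF sz).
- exact: cf.
- exact: cont Ux (fun y => E1 v y) (cD v x Ux).
- exact: cont Ux (fun y => E2 w v y) (cDD w v x Ux).
- by case: (notF sz).
Unshelve. all: by end_near. Qed.

End SecondDerivatives.

(** * The metric and the Laplacian in coordinates *)

Section Coordinates.
Context {R : realType}.
#[local] Opaque derive pd ei dot3.
Implicit Types (f : R * R -> 'rV[R]_3) (w : R * R -> R) (q : R * R).

Definition i0 : 'I_2 := ord0.
Definition i1 : 'I_2 := lift ord0 ord0.

Lemma sum2 (F : 'I_2 -> R) : \sum_(i < 2) F i = F i0 + F i1.
Proof. by rewrite !big_ord_recl big_ord0 addr0. Qed.

Definition first_form f i j q : R := dot3 (pd f i q) (pd f j q).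
Definition gram f q : R :=
  first_form f i0 i0 q * first_form f i1 i1 q - first_form f i0 i1 q ^+ 2.

Lemma lift_i0_ord0 : lift i0 ord0 = i1.
Proof. exact/val_inj. Qed.

Lemma lift_i1_ord0 : lift i1 ord0 = i0.
Proof. exact/val_inj. Qed.

Lemma det_mx2 (A : 'M[R]_2) : \det A = A i0 i0 * A i1 i1 - A i0 i1 * A i1 i0.
Proof.
rewrite (expand_det_row _ ord0) sum2 /cofactor !det_mx11 !mxE /=.
rewrite !lift_i0_ord0 !lift_i1_ord0.
by rewrite expr0 expr1; ring.
Qed.

Lemma invmx2E (A : 'M[R]_2) (d : R) : \det A = d -> d != 0 ->
  [/\ invmx A i0 i0 = A i1 i1 / d, invmx A i0 i1 = - A i0 i1 / d,
      invmx A i1 i0 = - A i1 i0 / d & invmx A i1 i1 = A i0 i0 / d].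
Proof.
move=> Ad d0; have AU : A \in unitmx by rewrite unitmxE Ad unitfE.
rewrite /invmx AU !mxE Ad /cofactor !det_mx11 !mxE /=.
rewrite !lift_i0_ord0 !lift_i1_ord0.
by rewrite expr0 expr1 expr2; split; ring.
Qed.

Lemma det_gram2 (c : 'I_2 -> 'rV[R]_3) :
  \det (\matrix_(i < 2, j < 2) dot3 (c i) (c j)) =
  dot3 (c i0) (c i0) * dot3 (c i1) (c i1) - dot3 (c i0) (c i1) ^+ 2.
Proof. by rewrite det_mx2 !mxE (dot3C (c i1) (c i0)) expr2. Qed.

Lemma invmx_gram2 (c : 'I_2 -> 'rV[R]_3) (d : R) :
  dot3 (c i0) (c i0) * dot3 (c i1) (c i1) - dot3 (c i0) (c i1) ^+ 2 = d ->
  d != 0 -> let B := invmx (\matrix_(i < 2, j < 2) dot3 (c i) (c j)) in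
  [/\ B i0 i0 = dot3 (c i1) (c i1) / d, B i0 i1 = - dot3 (c i0) (c i1) / d,
      B i1 i0 = - dot3 (c i0) (c i1) / d & B i1 i1 = dot3 (c i0) (c i0) / d].
Proof.
rewrite -det_gram2 => cd d0 B; have [-> -> -> ->] := invmx2E cd d0.
by rewrite !mxE (dot3C (c i1) (c i0)).
Qed.

Lemma det_metric f q : \det (metric f q) = gram f q.
Proof. exact: (det_gram2 (fun i => pd f i q)). Qed.

Lemma imetricE f q : gram f q != 0 ->
  [/\ imetric f q i0 i0 = first_form f i1 i1 q / gram f q,
      imetric f q i0 i1 = - first_form f i0 i1 q / gram f q,
      imetric f q i1 i0 = - first_form f i0 i1 q / gram f q &
      imetric f q i1 i1 = first_form f i0 i0 q / gram f q].
Proof. exact: (@invmx_gram2 (fun i => pd f i q) (gram f q) erefl). Qed.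

(** This is the shape of a component of the flux sqrt(det g) g^{ij} d_j w in dimension two: the
    inverse metric is the adjugate over [D], so a single factor 1 / sqrt [D] survives. *)
Lemma is_derive_flux (g h u w D : R * R -> R) (q v : R * R) dg dh du dw dD :
  0 < D q ->
  is_derive q v g dg -> is_derive q v h dh -> is_derive q v u du ->
  is_derive q v w dw -> is_derive q v D dD ->
  is_derive q v (fun x => (g x * u x - h x * w x) * (Num.sqrt (D x))^-1)
    ((dg * u q + g q * du - dh * w q - h q * dw) / Num.sqrt (D q) -
     (g q * u q - h q * w q) * dD / (2 * Num.sqrt (D q) ^+ 3)).
Proof.
move=> D0 dg' dh' du' dw' dD'.
have s0 : Num.sqrt (D q) != 0 by rewrite gt_eqF // sqrtr_gt0.
have dnum := is_deriveB (is_derive_mul dg' du') (is_derive_mul dh' dw').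
have dden := is_derive_inv_comp (f := fun x => Num.sqrt (D x)) s0
  (is_derive_sqrt_comp D0 dD').
apply: is_derive_eq (is_derive_mul dnum dden) _.
move: (Num.sqrt (D q)) s0 => s s0 /=.
rewrite -[X in X * _ + _ = _]/(_ - _) -[X in _ + X * _ = _]/(_ - _).
by field.
Qed.

(** [P] and [Q] play the coordinate tangent vectors and [w0], [w1] the partial derivatives of a
    function; [wij] is the derivative of [wj] along [vi]. [D0] and [D1] are the derivatives of the
    Gram determinant and enter through the factor 1 / sqrt [D]. *)
Lemma flux_divergence (P Q : R * R -> 'rV[R]_3) (w0 w1 : R * R -> R)
    (q v0 v1 : R * R) (A0 A1 B0 B1 : 'rV[R]_3) (w00 w01 w10 w11 : R) :
  let gr x := dot3 (P x) (P x) * dot3 (Q x) (Q x) - dot3 (P x) (Q x) ^+ 2 in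
  0 < gr q ->
  is_derive q v0 P A0 -> is_derive q v1 P A1 ->
  is_derive q v0 Q B0 -> is_derive q v1 Q B1 ->
  is_derive q v0 w0 w00 -> is_derive q v1 w0 w10 ->
  is_derive q v0 w1 w01 -> is_derive q v1 w1 w11 ->
  (Num.sqrt (gr q))^-1 *
    ('D_v0 (fun x => (dot3 (Q x) (Q x) * w0 x - dot3 (P x) (Q x) * w1 x)
             * (Num.sqrt (gr x))^-1) q +
     'D_v1 (fun x => (dot3 (P x) (P x) * w1 x - dot3 (P x) (Q x) * w0 x)
             * (Num.sqrt (gr x))^-1) q) =
  let A := P q in let B := Q q in
  let E := dot3 A A in let F := dot3 A B in let G := dot3 B B in
  let D := E * G - F ^+ 2 in
  let D0 := 2 * (dot3 A0 A * G + E * dot3 B0 B - F * (dot3 A0 B + dot3 A B0)) in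
  let D1 := 2 * (dot3 A1 A * G + E * dot3 B1 B - F * (dot3 A1 B + dot3 A B1)) in
    (G * w00 - F * (w01 + w10) + E * w11) / D +
    (2 * dot3 B0 B - (dot3 A1 B + dot3 A B1) - (G * D0 - F * D1) / (2 * D)) / D
      * w0 q +
    (2 * dot3 A1 A - (dot3 A0 B + dot3 A B0) - (E * D1 - F * D0) / (2 * D)) / D
      * w1 q.
Proof.
move=> gr gr_gt0 dP0 dP1 dQ0 dQ1 dw00 dw10 dw01 dw11.
have dgr v a b : is_derive q v P a -> is_derive q v Q b ->
    is_derive q v gr (2 * (dot3 a (P q) * dot3 (Q q) (Q q)
      + dot3 (P q) (P q) * dot3 b (Q q)
      - dot3 (P q) (Q q) * (dot3 a (Q q) + dot3 (P q) b))).
  move=> da db; have dF := is_derive_dot3 da db.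
  apply: is_derive_eq (is_deriveB (is_derive_mul (is_derive_dot3 da da)
    (is_derive_dot3 db db)) (is_derive_mul dF dF)) _.
  by rewrite (dot3C (P q) a) (dot3C (Q q) b); ring.
have flux0 := is_derive_flux gr_gt0 (is_derive_dot3 dQ0 dQ0)
  (is_derive_dot3 dP0 dQ0) dw00 dw01 (dgr _ _ _ dP0 dQ0).
have flux1 := is_derive_flux gr_gt0 (is_derive_dot3 dP1 dP1)
  (is_derive_dot3 dP1 dQ1) dw11 dw10 (dgr _ _ _ dP1 dQ1).
rewrite (@derive_val _ _ _ _ _ _ _ flux0) (@derive_val _ _ _ _ _ _ _ flux1).
have s2 : Num.sqrt (gr q) ^+ 2 = gr q by rewrite sqr_sqrtr // ltW.
have s_neq0 : Num.sqrt (gr q) != 0 by rewrite gt_eqF // sqrtr_gt0.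
cbv zeta; rewrite -/(gr q) (dot3C (Q q) B0) (dot3C (P q) A1).
(* Writing [gr q] as [s ^+ 2] makes the identity rational in [s]. *)
move: (Num.sqrt (gr q)) s2 s_neq0 => s <- s_neq0.
by field.
Qed.

(** On [U] the metric is invertible and its inverse is the adjugate over the determinant, so near
    [q] the flux in [lap_coord] is the one of [flux_divergence], and derivatives at [q] only see
    values near [q]. *)
Lemma lap_coordE U f w q (A0 A1 B0 B1 : 'rV[R]_3) (w00 w01 w10 w11 : R) :
  open U -> U q -> (forall x, U x -> 0 < gram f x) ->
  is_derive q (ei R i0) (pd f i0) A0 -> is_derive q (ei R i1) (pd f i0) A1 ->
  is_derive q (ei R i0) (pd f i1) B0 -> is_derive q (ei R i1) (pd f i1) B1 ->
  is_derive q (ei R i0) (pd w i0) w00 -> is_derive q (ei R i1) (pd w i0) w10 ->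
  is_derive q (ei R i0) (pd w i1) w01 -> is_derive q (ei R i1) (pd w i1) w11 ->
  let A := pd f i0 q in let B := pd f i1 q in
  let E := dot3 A A in let F := dot3 A B in let G := dot3 B B in
  let D := E * G - F ^+ 2 in
  let D0 := 2 * (dot3 A0 A * G + E * dot3 B0 B - F * (dot3 A0 B + dot3 A B0)) in
  let D1 := 2 * (dot3 A1 A * G + E * dot3 B1 B - F * (dot3 A1 B + dot3 A B1)) in
  lap_coord f w q =
    (G * w00 - F * (w01 + w10) + E * w11) / D +
    (2 * dot3 B0 B - (dot3 A1 B + dot3 A B1) - (G * D0 - F * D1) / (2 * D)) / D
      * pd w i0 q +
    (2 * dot3 A1 A - (dot3 A0 B + dot3 A B0) - (E * D1 - F * D0) / (2 * D)) / D
      * pd w i1 q.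
Proof.
move=> oU Uq gram_gt0 dA0 dA1 dB0 dB1 dw00 dw10 dw01 dw11.
apply: etrans (flux_divergence (gram_gt0 q Uq) dA0 dA1 dB0 dB1 dw00 dw10 dw01 dw11).
have near_U : \forall x \near q, U x by exact: open_nbhs_nbhs.
have flux_coef (d a b u v : R) : 0 < d ->
    Num.sqrt d * (a / d * u + - b / d * v) = (a * u - b * v) * (Num.sqrt d)^-1.
  move=> d0; have s0 : Num.sqrt d != 0 by rewrite gt_eqF // sqrtr_gt0.
  rewrite -[in X in X + _](sqr_sqrtr (ltW d0)) -[in X in _ + X](sqr_sqrtr (ltW d0)).
  by field.
rewrite /lap_coord sum2 /sqrtg det_metric; congr (_ * (_ + _)).
- apply: near_eq_derive; apply: filterS near_U => x Ux.
  have [|E00 E01 _ _] := @imetricE f x; first by rewrite gt_eqF ?gram_gt0.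
  by rewrite det_metric sum2 E00 E01; exact: flux_coef (gram_gt0 x Ux).
- apply: near_eq_derive; apply: filterS near_U => x Ux.
  have [|_ _ E10 E11] := @imetricE f x; first by rewrite gt_eqF ?gram_gt0.
  by rewrite det_metric sum2 E10 E11 addrC; exact: flux_coef (gram_gt0 x Ux).
Qed.

End Coordinates.

(** * The barrier function *)

Section Barrier.
Context {R : realType}.
Implicit Types (x n e A B C : 'rV[R]_3) (a k : R).

(** A regularization of the norm: it is smooth at the origin, a point of the cone, and it is at
    least 1, which keeps the second derivatives of the barrier bounded. *)
Definition radius x : R := Num.sqrt (1 + dot3 x x).

Lemma radius_arg_gt0 x : 0 < 1 + dot3 x x.
Proof. by rewrite ltr_pwDl // dot3_ge0. Qed.

Lemma radius_gt0 x : 0 < radius x.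
Proof. by rewrite sqrtr_gt0 radius_arg_gt0. Qed.

Lemma radius_ge1 x : 1 <= radius x.
Proof.
have : Num.sqrt 1 <= radius x.
  by rewrite ler_sqrt ?lerDl ?dot3_ge0 // ltW // radius_arg_gt0.
by rewrite sqrtr1.
Qed.

Lemma norm3_le_radius x : norm3 x <= radius x.
Proof. by rewrite ler_sqrt ?lerDr // ltW // radius_arg_gt0. Qed.

Definition barrier a x : R := dot3 x (e3 R) - a * radius x.
Definition dbarrier a x A : R := dot3 A (e3 R) - a * (dot3 A x / radius x).
(** Second derivative of the barrier along a map: the Hessian at [x] on the pair [A], [B] plus the
    differential at [x] on the second derivative [C] of the map. *)
Definition ddbarrier a x A B C : R :=
  dot3 C (e3 R) - a * ((dot3 C x + dot3 A B) / radius x -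
                       dot3 A x * dot3 B x / radius x ^+ 3).

Lemma is_derive_radius (V : normedModType R) (f : V -> 'rV[R]_3) q v df :
  is_derive q v f df ->
  is_derive q v (fun y => radius (f y)) (dot3 df (f q) / radius (f q)).
Proof.
move=> fv.
have dsq := is_derive_add (is_derive_cst (1 : R) q v) (is_derive_dot3 fv fv).
have s0 : radius (f q) != 0 by rewrite gt_eqF ?radius_gt0.
have dr := is_derive_sqrt_comp (f := fun y => 1 + dot3 (f y) (f y))
  (radius_arg_gt0 (f q)) dsq.
refine (is_derive_eq dr _).
rewrite (dot3C (f q)) -/(radius (f q)) add0r.
by field.
Qed.

Lemma is_derive_barrier (V : normedModType R) a (f : V -> 'rV[R]_3) q v df :
  is_derive q v f df ->
  is_derive q v (fun y => barrier a (f y)) (dbarrier a (f q) df).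
Proof.
move=> fv; apply: is_derive_eq (is_deriveB
  (is_derive_dot3 fv (is_derive_cst (e3 R) q v))
  (is_derive_mul (is_derive_cst a q v) (is_derive_radius fv))) _.
by rewrite /dbarrier (_ : dot3 (f q) 0 = 0) ?addr0 ?mul0r ?add0r // dot3E !mxE; ring.
Qed.

Lemma is_derive_dbarrier (V : normedModType R) a (f g : V -> 'rV[R]_3) q v df dg :
  is_derive q v f df -> is_derive q v g dg ->
  is_derive q v (fun y => dbarrier a (f y) (g y)) (ddbarrier a (f q) (g q) df dg).
Proof.
move=> fv gv; have s0 : radius (f q) != 0 by rewrite gt_eqF ?radius_gt0.
apply: is_derive_eq (is_deriveB
  (is_derive_dot3 gv (is_derive_cst (e3 R) q v))
  (is_derive_mul (is_derive_cst a q v) (is_derive_mul (is_derive_dot3 gv fv)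
    (is_derive_inv_comp (f := fun y => radius (f y)) s0 (is_derive_radius fv))))) _.
rewrite /ddbarrier (_ : dot3 (g q) 0 = 0); last by rewrite dot3E !mxE; ring.
move: (radius (f q)) s0 => s s0.
by rewrite addr0 mul0r add0r /=; congr (_ - _ * _); field.
Qed.

Lemma continuous_radius (T : topologicalType) (f : T -> 'rV[R]_3) q :
  {for q, continuous f} -> {for q, continuous (fun y => radius (f y))}.
Proof.
move=> fq; apply: (@continuous_comp _ _ _ (fun y => 1 + dot3 (f y) (f y)) Num.sqrt).
  by apply: continuousD; [exact: cst_continuous | exact: continuous_dot3].
exact: sqrt_continuous.
Qed.

Lemma continuous_radiusV (T : topologicalType) (f : T -> 'rV[R]_3) q :
  {for q, continuous f} -> {for q, continuous (fun y => (radius (f y))^-1)}.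
Proof.
move=> fq; apply: continuousV; first by rewrite gt_eqF ?radius_gt0.
exact: continuous_radius.
Qed.

Lemma continuous_barrier (T : topologicalType) a (f : T -> 'rV[R]_3) q :
  {for q, continuous f} -> {for q, continuous (fun y => barrier a (f y))}.
Proof.
move=> fq; apply: continuousB.
  by apply: continuous_dot3; [by []|exact: cst_continuous].
by apply: continuousM; [exact: cst_continuous | exact: continuous_radius].
Qed.

Lemma continuous_dbarrier (T : topologicalType) a (f g : T -> 'rV[R]_3) q :
  {for q, continuous f} -> {for q, continuous g} ->
  {for q, continuous (fun y => dbarrier a (f y) (g y))}.
Proof.
move=> fq gq; apply: continuousB.
  by apply: continuous_dot3; [by []|exact: cst_continuous].
apply: continuousM; first exact: cst_continuous.
by apply: continuousM; [exact: continuous_dot3 | exact: continuous_radiusV].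
Qed.

Lemma continuous_ddbarrier (T : topologicalType) a (f g h l : T -> 'rV[R]_3) q :
  {for q, continuous f} -> {for q, continuous g} ->
  {for q, continuous h} -> {for q, continuous l} ->
  {for q, continuous (fun y => ddbarrier a (f y) (g y) (h y) (l y))}.
Proof.
move=> fq gq hq lq; apply: continuousB.
  by apply: continuous_dot3; [by []|exact: cst_continuous].
apply: continuousM; first exact: cst_continuous.
apply: continuousB; apply: continuousM.
- by apply: continuousD; exact: continuous_dot3.
- exact: continuous_radiusV.
- by apply: continuousM; exact: continuous_dot3.
- have cr := continuous_radiusV fq.
  rewrite (_ : (fun _ => _) = (fun y => (radius (f y))^-1 *
    ((radius (f y))^-1 * (radius (f y))^-1))).
    exact: (continuousM cr (continuousM cr cr)).
  by apply/funext => y; rewrite -exprVn !exprS expr0 mulr1.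
Qed.

Lemma Ck_on_barrier (V : normedModType R) a (U : set V) (f : V -> 'rV[R]_3) :
  open U -> Ck_on 2 U f -> Ck_on 2 U (fun y => barrier a (f y)).
Proof.
move=> oU [df cf].
have d1 v q : U q -> is_derive q v f ('D_v f q).
  by move=> Ux; apply: derivableP; exact: (df [::] v q).
have d2 v w q : U q -> is_derive q w ('D_v f) ('D_w ('D_v f) q).
  by move=> Ux; apply: derivableP; exact: (df [:: v] w q).
have c0 q : U q -> {for q, continuous f} by move=> Ux; exact: (cf [::] q).
have c1 v q : U q -> {for q, continuous ('D_v f)}.
  by move=> Ux; exact: (cf [:: v] q).
have c2 v w q : U q -> {for q, continuous ('D_w ('D_v f))}.
  by move=> Ux; exact: (cf [:: w; v] q).
apply: (Ck_on2_intro (D := fun v q => dbarrier a (f q) ('D_v f q))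
  (DD := fun v w q => ddbarrier a (f q) ('D_v f q) ('D_w f q) ('D_w ('D_v f) q)) oU).
- by move=> q Ux; apply: continuous_barrier (c0 q Ux).
- by move=> v q Ux; apply: is_derive_barrier (d1 v q Ux).
- by move=> v q Ux; apply: continuous_dbarrier (c0 q Ux) (c1 v q Ux).
- by move=> v w q Ux; apply: is_derive_dbarrier (d1 w q Ux) (d2 v w q Ux).
- move=> v w q Ux.
  exact: continuous_ddbarrier (c0 q Ux) (c1 v q Ux) (c1 w q Ux) (c2 v w q Ux).
Qed.

(** The coefficients of [A] and [B] solve the 2 by 2 Gram system, so the difference of the two sides
    is orthogonal to [A], [B] and [n]. With [e] the vertical vector, the tangential part is the
    gradient of the height. *)
Lemma tangent_frame A B n e :
  let E := dot3 A A in let F := dot3 A B in let G := dot3 B B in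
  let D := E * G - F ^+ 2 in
  0 < D -> dot3 n n = 1 -> dot3 n A = 0 -> dot3 n B = 0 ->
  e = dot3 n e *: n + ((G * dot3 A e - F * dot3 B e) / D) *: A +
      ((E * dot3 B e - F * dot3 A e) / D) *: B.
Proof.
move=> E F G D D_gt0 nn nA nB; apply/eqP; rewrite -subr_eq0; apply/eqP.
have D_neq0 : dot3 A A * dot3 B B - dot3 A B ^+ 2 != 0 by rewrite gt_eqF.
apply: (orthogonal_frame_eq0 D_gt0 nn nA nB);
  rewrite !dot3lin ?nn ?nA ?nB ?(dot3C A n) ?(dot3C B n) ?nA ?nB
    ?(dot3C B A) ?(dot3C e A) ?(dot3C e B) ?(dot3C e n) /D /E /F /G; by field.
Qed.

(* [C] is the mixed second derivative: the left-hand side is the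
   Laplace-Beltrami operator applied to the position vector. *)
Lemma laplacian_position A B A0 C B1 n k :
  let E := dot3 A A in let F := dot3 A B in let G := dot3 B B in
  let D := E * G - F ^+ 2 in
  let D0 := 2 * (dot3 A0 A * G + E * dot3 C B - F * (dot3 A0 B + dot3 A C)) in
  let D1 := 2 * (dot3 C A * G + E * dot3 B1 B - F * (dot3 C B + dot3 A B1)) in
  0 < D -> dot3 n n = 1 -> dot3 n A = 0 -> dot3 n B = 0 ->
  (G * dot3 A0 n - 2 * F * dot3 C n + E * dot3 B1 n) / D = k ->
  D^-1 *: (G *: A0 - (2 * F) *: C + E *: B1) +
  ((2 * dot3 C B - (dot3 C B + dot3 A B1) - (G * D0 - F * D1) / (2 * D)) / D) *: A +
  ((2 * dot3 C A - (dot3 A0 B + dot3 A C) - (E * D1 - F * D0) / (2 * D)) / D) *: B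
  = k *: n.
Proof.
move=> E F G D D0 D1 D_gt0 nn nA nB <-; apply/eqP; rewrite -subr_eq0; apply/eqP.
have D_neq0 : dot3 A A * dot3 B B - dot3 A B ^+ 2 != 0 by rewrite gt_eqF.
(* The coefficients of [A] and [B] are minus the traced Christoffel symbols, so pairing with [A] or
   [B] gives zero identically; pairing with [n] leaves the traced second fundamental form. *)
apply: (orthogonal_frame_eq0 D_gt0 nn nA nB);
  rewrite !dot3lin ?nn ?nA ?nB ?(dot3C A n) ?(dot3C B n) ?nA ?nB /D0 /D1 /D /E /F /G
    ?(dot3C B A) ?(dot3C A C) ?(dot3C A B1); by field.
Qed.

(** The drift Laplacian of the barrier equals [k] times its vertical derivative plus the tangential
    trace of its Hessian. In that trace, only the nonnegative contribution of the tangential part of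
    [x] is dropped. *)
Lemma barrier_laplacian_ge A B A0 C B1 n x k a :
  let E := dot3 A A in let F := dot3 A B in let G := dot3 B B in
  let D := E * G - F ^+ 2 in
  let D0 := 2 * (dot3 A0 A * G + E * dot3 C B - F * (dot3 A0 B + dot3 A C)) in
  let D1 := 2 * (dot3 C A * G + E * dot3 B1 B - F * (dot3 C B + dot3 A B1)) in
  let w0 := dbarrier a x A in let w1 := dbarrier a x B in
  let z0 := dot3 A (e3 R) in let z1 := dot3 B (e3 R) in
  0 < D -> dot3 n n = 1 -> dot3 n A = 0 -> dot3 n B = 0 -> 0 <= a ->
  (G * dot3 A0 n - 2 * F * dot3 C n + E * dot3 B1 n) / D = k * dot3 n (e3 R) ->
  k * (1 - a * dot3 x (e3 R) / radius x) - 2 * a / radius x <=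
  (G * ddbarrier a x A A A0 - F * (ddbarrier a x B A C + ddbarrier a x A B C) +
   E * ddbarrier a x B B B1) / D +
  ((2 * dot3 C B - (dot3 C B + dot3 A B1) - (G * D0 - F * D1) / (2 * D)) / D) * w0 +
  ((2 * dot3 C A - (dot3 A0 B + dot3 A C) - (E * D1 - F * D0) / (2 * D)) / D) * w1 +
  k * ((G * z0 * w0 - F * (z0 * w1 + z1 * w0) + E * z1 * w1) / D).
Proof.
move=> E F G D D0 D1 w0 w1 z0 z1 D_gt0 nn nA nB a_ge0 Hn.
set c0 := (2 * dot3 C B - _ - _) / D; set c1 := (2 * dot3 C A - _ - _) / D.
(* [nu] is the gradient of the barrier at [x], kept abstract so that the vector identities can be
   paired with it. *)
have [nu nu_def] : {nu : 'rV[R]_3 | nu = e3 R - (a / radius x) *: x}.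
  by exists (e3 R - (a / radius x) *: x).
have r_gt0 := radius_gt0 x; have r_neq0 : radius x != 0 by rewrite gt_eqF.
have w0E : w0 = dot3 A nu by rewrite /w0 /dbarrier nu_def !dot3lin; field.
have w1E : w1 = dot3 B nu by rewrite /w1 /dbarrier nu_def !dot3lin; field.
have ddE P Q S : ddbarrier a x P Q S = dot3 S nu -
    a * (dot3 P Q / radius x - dot3 P x * dot3 Q x / radius x ^+ 3).
  by rewrite /ddbarrier nu_def !dot3lin; field.
have nuE : dot3 (e3 R) nu = 1 - a * dot3 x (e3 R) / radius x.
  by rewrite nu_def !dot3lin e3_dot3 (dot3C x); field.
(* Paired with [nu], the Laplacian of the position gives [k] times the normal part of the vertical
   derivative; the frame decomposition below identifies the drift term with the tangential part. *)
have := congr1 (fun y => dot3 y nu) (laplacian_position D_gt0 nn nA nB Hn).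
have := congr1 (fun y => dot3 y nu) (tangent_frame (e3 R) D_gt0 nn nA nB).
rewrite /= !dot3lin nuE -/E -/F -/G -/D -/z0 -/z1 -/D0 -/D1 -/c0 -/c1 -w0E -w1E.
rewrite !ddE (dot3C B A) -/E -/F -/G.
(* This squared length is [D] times the squared length of the tangential part of [x]; divided by
   [D], it is the trace of the rank-one term of the Hessian. *)
have T_ge0 := dot3_ge0 (dot3 A x *: B - dot3 B x *: A).
rewrite !dot3lin (dot3C B A) -/E -/F -/G in T_ge0.
have D_neq0 : E * G - F ^+ 2 != 0 by rewrite gt_eqF.
set T := (X in 0 <= X) in T_ge0.
move=> tf lp.
(* The constant 2 is the trace of the metric against its inverse; inserting the factor [D / D] puts
   both sides over the same denominator. *)
rewrite [leLHS](_ : _ = k * (1 - a * dot3 x (e3 R) / radius x) -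
  2 * a / radius x * ((E * G - F ^+ 2) / D)); last by rewrite divff // mulr1.
rewrite tf mulrDr mulrDr [k * (_ * _)]mulrA -lp -subr_ge0.
rewrite (_ : _ - _ = a * T / (radius x ^+ 3 * D)).
  by rewrite !mulr_ge0 // invr_ge0 mulr_ge0 ?exprn_ge0 // ltW.
by rewrite /T /D; field; rewrite D_neq0.
Qed.

End Barrier.

(** Pairing with an arbitrary fixed [c] reduces the claim to the scalar [derive_comm], and
    [dot3_inj] recovers the vectors. *)
Lemma derive_comm_row3 (R : realType) (V : normedModType R) (U : set V)
    (f : V -> 'rV[R]_3) (q v w : V) :
  open U -> U q -> Ck_on 2 U f -> 'D_w ('D_v f) q = 'D_v ('D_w f) q.
Proof.
move=> oU Uq [df cf]; apply: dot3_inj => c.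
have d1 u x : U x -> is_derive x u f ('D_u f x).
  by move=> Ux; apply: derivableP; exact: (df [::] u x).
have d2 u u' x : U x -> is_derive x u' ('D_u f) ('D_u' ('D_u f) x).
  by move=> Ux; apply: derivableP; exact: (df [:: u] u' x).
pose g x := dot3 (f x) c.
have dotc (h : V -> 'rV[R]_3) u x dh : is_derive x u h dh ->
    is_derive x u (fun y => dot3 (h y) c) (dot3 dh c).
  move=> hu; apply: is_derive_eq (is_derive_dot3 hu (is_derive_cst c x u)) _.
  by rewrite (_ : dot3 (h x) 0 = 0) ?addr0 // dot3E !mxE; ring.
have g1 u x : U x -> 'D_u g x = dot3 ('D_u f x) c.
  by move=> Ux; exact: (@derive_val _ _ _ _ _ _ _ (dotc _ _ _ _ (d1 u x Ux))).
have near_U x : U x -> \forall y \near x, U y.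
  by move=> Ux; exact: open_nbhs_nbhs.
have dg1 u u' x : U x -> is_derive x u' ('D_u g) (dot3 ('D_u' ('D_u f) x) c).
  move=> Ux; apply: near_eq_is_derive (dotc _ _ _ _ (d2 u u' x Ux)).
  by apply: filterS (near_U x Ux) => y Uy; exact/esym/g1.
have g2 u u' x : U x -> 'D_u' ('D_u g) x = dot3 ('D_u' ('D_u f) x) c.
  by move=> Ux; exact: (@derive_val _ _ _ _ _ _ _ (dg1 u u' x Ux)).
have cg2 u u' : {for q, continuous ('D_u' ('D_u g))}.
  have h : {for q, continuous (fun y => dot3 ('D_u' ('D_u f) y) c)}.
    apply: continuous_dot3; last exact: cst_continuous.
    exact: (cf [:: u'; u] q).
  rewrite /prop_for /continuous_at g2 //; apply: cvg_trans h.
  apply: near_eq_cvg; apply: filterS (near_U q Uq) => y Uy.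
  exact/esym/g2.
have dg0 z x : U x -> derivable g x z.
  by move=> Ux; exact: (@ex_derive _ _ _ _ _ _ _ (dotc _ _ _ _ (d1 z x Ux))).
have ddg z z' x : U x -> derivable ('D_z g) x z'.
  by move=> Ux; exact: (@ex_derive _ _ _ _ _ _ _ (dg1 z z' x Ux)).
have comm := derive_comm oU Uq (fun x Ux => conj (dg0 v x Ux) (dg0 w x Ux))
  (fun x Ux => conj (ddg v w x Ux) (ddg w v x Ux)) (cg2 v w) (cg2 w v).
exact: etrans (esym (g2 v w q Uq)) (etrans comm (g2 w v q Uq)).
Qed.

Lemma scale_unit_inj (R : realType) (n : 'rV[R]_3) (b c : R) :
  dot3 n n = 1 -> b *: n = c *: n -> b = c.
Proof.
move=> nn /(congr1 (fun y => dot3 y n)).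
by rewrite !dot3Zl nn !mulr1.
Qed.

(** * Contractions with the inverse of a 2 by 2 metric *)

Section InverseMetricSums.
Context {R : realType}.

Lemma sum22 (F : 'I_2 -> 'I_2 -> R) : \sum_(i < 2) \sum_(j < 2) F i j =
  F i0 i0 + F i0 i1 + (F i1 i0 + F i1 i1).
Proof. by rewrite sum2 !sum2. Qed.

Variables (m00 m01 m10 m11 g h e d : R).
Hypotheses (I00 : m00 = g / d) (I01 : m01 = - h / d) (I10 : m10 = - h / d).
Hypothesis I11 : m11 = e / d.

(** Here [e], [h], [g] stand for the coefficients E, F, G. The [hi] are the partial derivatives of
    [phi] of the height and the [zi] those of the height, so [k] is the derivative of [phi]. *)
Lemma grad_dot_expand (k z0 z1 w0 w1 h0 h1 : R) : h0 = k * z0 -> h1 = k * z1 ->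
  m00 * h0 * w0 + m01 * h0 * w1 + (m10 * h1 * w0 + m11 * h1 * w1) =
  k * ((g * z0 * w0 - h * (z0 * w1 + z1 * w0) + e * z1 * w1) / d).
Proof. by rewrite I00 I01 I10 I11 => -> ->; ring. Qed.

Lemma trace_expand (b c c' b' : R) : c' = c ->
  (g * b - 2 * h * c + e * b') / d =
  m00 * b + m01 * c + (m10 * c' + m11 * b').
Proof. by rewrite I00 I01 I10 I11 => ->; ring. Qed.

Lemma lower_bound_subst (l r k b c0 c1 z0 z1 w0 w1 w0' w1' m : R) :
  l = b + c0 * w0 + c1 * w1 ->
  r = k * ((g * z0 * w0 - h * (z0 * w1 + z1 * w0) + e * z1 * w1) / d) ->
  w0 = w0' -> w1 = w1' ->
  m <= b + c0 * w0' + c1 * w1' +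
    k * ((g * z0 * w0' - h * (z0 * w1' + z1 * w0') + e * z1 * w1') / d) ->
  m <= l + r.
Proof. by move=> -> -> -> ->. Qed.

End InverseMetricSums.

(** * The drift Laplacian of the barrier on a minimal surface *)

Section SurfaceBarrier.
Context {R : realType} {M : topologicalType}.
Variables (a : R) (phi : R -> R) (X N : M -> 'rV[R]_3).

Let u (p : M) : R := barrier a (X p).

Lemma C2_barrier : C2 X u.
Proof.
move=> U psi [oU _ _ _ [smX _]].
exact: (Ck_on_barrier a oU (smX 2)).
Qed.

Lemma lap_phi_barrier_ge (U : set (R * R)) (psi : R * R -> M) (q : R * R) :
  0 <= a -> derivable phi (height X (psi q)) 1 -> unit_normal X N ->
  phi_e3_minimal X phi N -> chart X U psi -> U q ->
  derive1 phi (height X (psi q)) *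
    (1 - a * dot3 (X (psi q)) (e3 R) / radius (X (psi q)))
    - 2 * a / radius (X (psi q)) <=
  lap_phi_coord X phi U psi u q.
Proof.
move=> a_ge0 dphi [_ NN NX] minX chartU Uq.
set k := derive1 phi _; set x := X (psi q).
have Hmin := minX U psi chartU q Uq.
have nX := NX U psi chartU q Uq.
have nn := NN (psi q); set n := N (psi q) in Hmin nX nn.
case: chartU => oU _ _ _ [/(_ 2) smf free].
rewrite /lap_phi_coord.
have xE : x = (X \o psi) q by [].
have heightE : phi \o height X \o psi =
  fun y => phi (dot3 ((X \o psi) y) (e3 R)) by [].
have uE : u \o psi = fun y => barrier a ((X \o psi) y) by [].
have kE : k = derive1 phi (dot3 ((X \o psi) q) (e3 R)) by [].
have dphi' : derivable phi (dot3 ((X \o psi) q) (e3 R)) 1 by [].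
have {}Hmin : meancurv_coord (X \o psi) n q = (k * dot3 n (e3 R)) *: n by [].
rewrite heightE uE xE.
clear dphi xE heightE uE x.
(* From here on the surface is a single parametrized patch [f] with unit normal [n] at [q]. *)
move: (X \o psi) smf free nX kE dphi' Hmin => f.
clearbody k n => smf free nX kE dphi Hmin.
have [df _] := smf.
have gram_pos y : U y -> 0 < gram f y by move=> Uy; exact: gram_gt0 (free y Uy).
have d1 v y : U y -> is_derive y v f ('D_v f y).
  by move=> Uy; apply: derivableP; exact: (df [::] v y).
have d2 v v' : is_derive q v' ('D_v f) ('D_v' ('D_v f) q).
  by apply: derivableP; exact: (df [:: v] v' q).
pose w y := barrier a (f y).
have w1 v y : U y -> 'D_v w y = dbarrier a (f y) ('D_v f y).
  by move=> Uy; exact: (@derive_val _ _ _ _ _ _ _ (is_derive_barrier a (d1 v y Uy))).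
have dw1 v v' : is_derive q v' ('D_v w)
    (ddbarrier a (f q) ('D_v f q) ('D_v' f q) ('D_v' ('D_v f) q)).
  apply: near_eq_is_derive (is_derive_dbarrier a (d1 v' q Uq) (d2 v v')).
  by apply: filterS (open_nbhs_nbhs (conj oU Uq)) => y Uy; exact/esym/w1.
have mixed := derive_comm_row3 (ei R i0) (ei R i1) oU Uq smf.
have D_gt0 := gram_pos q Uq.
have D_neq0 : gram f q != 0 by rewrite gt_eqF.
have [I00 I01 I10 I11] := imetricE D_neq0.
have gradE : grad_dot_coord f (fun y => phi (dot3 (f y) (e3 R))) w q =
    k * ((dot3 (pd f i1 q) (pd f i1 q) * dot3 (pd f i0 q) (e3 R) * pd w i0 q -
          dot3 (pd f i0 q) (pd f i1 q) * (dot3 (pd f i0 q) (e3 R) * pd w i1 q +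
          dot3 (pd f i1 q) (e3 R) * pd w i0 q) +
          dot3 (pd f i0 q) (pd f i0 q) * dot3 (pd f i1 q) (e3 R) * pd w i1 q)
         / gram f q).
  have dh i : pd (fun y => phi (dot3 (f y) (e3 R))) i q = k * dot3 (pd f i q) (e3 R).
    have dz := is_derive_dot3 (d1 (ei R i) q Uq) (is_derive_cst (e3 R) q (ei R i)).
    have dphi1 : is_derive (dot3 (f q) (e3 R)) (1 : R) phi k.
      by rewrite kE derive1E; exact: derivableP.
    have dc := is_derive_comp1 (f := fun y => dot3 (f y) (e3 R)) dz dphi1.
    have fq0 : dot3 (f q) 0 = 0 by rewrite dot3E !mxE; ring.
    by apply: etrans (@derive_val _ _ _ _ _ _ _ dc) _; rewrite fq0 addr0.
  apply: etrans (sum22 _) _.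
  exact: (grad_dot_expand I00 I01 I10 I11 _ _ (dh i0) (dh i1)).
have curvE : (dot3 (pd f i1 q) (pd f i1 q) * dot3 ('D_(ei R i0) (pd f i0) q) n -
    2 * dot3 (pd f i0 q) (pd f i1 q) * dot3 ('D_(ei R i0) (pd f i1) q) n +
    dot3 (pd f i0 q) (pd f i0 q) * dot3 ('D_(ei R i1) (pd f i1) q) n) / gram f q =
    k * dot3 n (e3 R).
  (* Both sides of the minimality equation are multiples of the unit vector [n], so their
     coefficients agree; symmetry of the mixed derivatives merges the off-diagonal terms. *)
  apply: etrans _ (scale_unit_inj nn Hmin); apply: etrans _ (esym (sum22 _)).
  refine (trace_expand I00 I01 I10 I11 _ _ _).
  exact: (congr1 (fun y => dot3 y n) mixed).
(* [lap_coordE] allows two different mixed derivatives, while [barrier_laplacian_ge] has a single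
   [C]; both orders are given the same value here, first for [f], then for [w]. *)
have d10 := is_derive_eq (d2 (ei R i0) (ei R i1)) mixed.
have dw10 := is_derive_eq (dw1 (ei R i0) (ei R i1))
  (congr1 (ddbarrier a (f q) ('D_(ei R i0) f q) ('D_(ei R i1) f q)) mixed).
have lapE := lap_coordE (w := w) oU Uq gram_pos (d2 _ _) d10 (d2 _ _) (d2 _ _)
  (dw1 _ _) dw10 (dw1 _ _) (dw1 _ _).
have lower := barrier_laplacian_ge (f q) D_gt0 nn (nX i0) (nX i1) a_ge0 curvE.
refine (lower_bound_subst lapE gradE (w1 _ q Uq) (w1 _ q Uq) _).
exact: lower.
Qed.

End SurfaceBarrier.

(** * The contradiction with stochastic completeness *)

Theorem theoremE (R : realType) (a : R) (phi : R -> R) :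
  0 < a -> a < 1 -> smooth_on [set: R] phi ->
  forall (M : topologicalType) (X N : M -> 'rV[R]_3),
  immersed_surface X -> unit_normal X N ->
  phi_e3_minimal X phi N -> phi_stoch_complete X phi ->
  (forall p, in_cone a (X p)) ->
  ~ (exists xi : R, 2 * a / (1 - a ^+ 2) < xi /\
       forall p, xi < derive1 phi (height X p)).
Proof.
move=> a_gt0 a_lt1 smooth_phi M X N [_ _ _ charts] normalN minX complete cone.
move=> [xi [xi_gt phi_gt]].
have a2_gt0 : 0 < 1 - a ^+ 2 by rewrite subr_gt0 expr_lt1 ?ltW.
(* The threshold imposed on [xi] is precisely the positivity of this gap. *)
have gap_gt0 : 0 < xi * (1 - a ^+ 2) - 2 * a by rewrite subr_gt0 -ltr_pdivrMr.
have xi_gt0 : 0 < xi.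
  by apply: lt_trans xi_gt; rewrite divr_gt0 // mulr_gt0.
have coneE p : dot3 (X p) (e3 R) <= a * radius (X p).
  by apply: le_trans (cone p) _; rewrite ler_pM2l // norm3_le_radius.
have ub : has_ubound (range (fun p => barrier a (X p))).
  by exists 0 => _ [p _ <-]; rewrite subr_le0.
have [pn pnP] := complete _ (C2_barrier (X := X) a) ub.
(* An Archimedean choice: at this index the upper bound on the drift Laplacian falls below the
   gap. *)
pose n := Num.bound (xi * (1 - a ^+ 2) - 2 * a)^-1.
have n_large : (n.+1%:R)^-1 < xi * (1 - a ^+ 2) - 2 * a.
  rewrite invf_plt ?posrE //.
  by apply: lt_le_trans (archi_boundP _) _; rewrite ?ler_nat // invr_ge0 ltW.
have [U [psi [chartU [q Uq psiq]]]] := charts (pn n).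
have [_ /(_ U psi chartU q Uq psiq)] := pnP n.
apply/negP; rewrite -leNgt; apply: le_trans (ltW n_large) _.
have dphi : derivable phi (height X (psi q)) 1.
  exact: ((smooth_phi 1%N).1 [::] 1 (height X (psi q))).
apply: le_trans (lap_phi_barrier_ge (ltW a_gt0) dphi normalN minX chartU Uq).
have r_gt0 := radius_gt0 (X (psi q)); have r_ge1 := radius_ge1 (X (psi q)).
(* The cone condition bounds the vertical derivative of the barrier below by [1 - a ^+ 2], and
   [radius] being at least 1 bounds the Hessian loss by [2 * a]. *)
apply: lerB.
  apply: ler_pM; [exact: ltW|exact: ltW|exact/ltW/phi_gt|].
  by rewrite lerD2l lerN2 ler_pdivrMr // expr2 -mulrA ler_pM2l.
by rewrite ler_pdivrMr // ler_peMr // mulr_ge0 // ltW.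
Qed.
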